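(* Let $\mathbb{H}_1,\mathbb{H}_2$ be complex Hilbert spaces and let $T=\begin{pmatrix}A&B\\ C&D\end{pmatrix}$ be the operator on $\mathbb{H}_1\oplus\mathbb{H}_2$ with $A\in B(\mathbb{H}_1)$, $B\in B(\mathbb{H}_2,\mathbb{H}_1)$, $C\in B(\mathbb{H}_1,\mathbb{H}_2)$, $D\in B(\mathbb{H}_2)$. Then $$w(T)\le\frac12\left[w(A)+w(D)+\sqrt{(w(A)-w(D))^2+4\alpha_1^2}\right],$$ where $$\alpha_1=\left[\frac18\max\left\{\left(\|B\|^2+\|C\|^2\right)^2+4w^2(BC),\ \left(\|B\|^2+\|C\|^2\right)^2+4w^2(CB)\right\}\right]^{\frac14}.$$
   Context: $B(\mathbb{H},\mathbb{K})$ is the set of bounded linear operators from $\mathbb{H}$ into $\mathbb{K}$, $B(\mathbb{H})=B(\mathbb{H},\mathbb{H})$, and $\|\cdot\|$ is the operator norm. The numerical radius of a bounded operator $S$ on a complex Hilbert space $\mathbb{H}$ is $w(S)=\sup\{|\langle Sx,x\rangle| : x\in\mathbb{H},\ \|x\|=1\}$, and $w^2(S)$ means $(w(S))^2$. *)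

(* Defs.v *)
From HB Require Import structures.
From mathcomp Require Import all_boot all_order all_algebra sesquilinear.
From mathcomp Require Import complex ring.
From mathcomp Require Import all_classical all_reals all_analysis.

Set Implicit Arguments.
Unset Strict Implicit.
Unset Printing Implicit Defensive.

Import Order.TTheory GRing.Theory Num.Theory.
Import numFieldNormedType.Exports.

Local Open Scope classical_set_scope.
Local Open Scope ring_scope.

(* Complex Hilbert spaces are obtained for [C := R[i]] with [R : realType].
   Norms over [C] are [C]-valued. *)
HB.mixin Record isHilbert (C : numClosedFieldType) H
    & CompleteNormedModule C H := {
  inner : H -> H -> C;
  inner_linearl : forall y, linear_for *%R (inner ^~ y);
  inner_conj : forall x y, inner x y = (inner y x)^*;
  norm_inner : forall x, `|x| = sqrtC (inner x x)
}.

#[short(type="hilbertType")]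
HB.structure Definition Hilbert (C : numClosedFieldType) :=
  {H of CompleteNormedModule C H & isHilbert C H}.

Section InnerDot.
Context {C : numClosedFieldType} {H : hilbertType C}.

Lemma inner_bilinear :
  bilinear_for (GRing.Scale.Law.clone _ _ *%R _)
    (GRing.Scale.Law.clone _ _ (@Num.conj C \; *%R) _) (@inner C H).
Proof.
split=> [y|x]; first exact: inner_linearl.
move=> a u v /=; rewrite (inner_conj x (_ + _)) inner_linearl rmorphD rmorphM/=.
by rewrite (inner_conj x u) (inner_conj x v).
Qed.

HB.instance Definition _ :=
  bilinear_isBilinear.Build C H H C _ _ (@inner C H) inner_bilinear.

Let inner_herm (x y : H) : inner x y = (-1) ^+ false * (inner y x)^*.
Proof. by rewrite expr0 mul1r -inner_conj. Qed.

HB.instance Definition _ :=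
  isHermitianSesquilinear.Build C H false (@Num.conj C) (@inner C H) inner_herm.

Let inner_gt0 (x : H) : x != 0 -> 0 < inner x x.
Proof. by rewrite -normr_gt0 norm_inner sqrtC_gt0. Qed.

HB.instance Definition _ := isDotProduct.Build C H (@inner C H) inner_gt0.

Lemma sqr_norm_inner (x : H) : (`|x| : C) ^+ 2 = inner x x.
Proof. by rewrite norm_inner (sqrtCK (inner x x)). Qed.

End InnerDot.

HB.mixin Record isBounded (C : numClosedFieldType) (H K : hilbertType C)
    (f : H -> K) := {
  bounded_subproof : exists2 M : C, 0 <= M & forall x, `|f x| <= M * `|x|
}.

HB.structure Definition BoundedLinear (C : numClosedFieldType)
    (H K : hilbertType C) :=
  {f of @GRing.Linear C H K *:%R f & isBounded C H K f}.

Notation "''B' ( H , K )" := (@BoundedLinear.type _ H K)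
  (at level 8, format "''B' ( H ,  K )") : type_scope.

Section BoundedComp.
Context {C : numClosedFieldType} {H K L : hilbertType C}.
Variables (g : 'B(K, L)) (f : 'B(H, K)).

Let comp_bounded : exists2 M : C, 0 <= M & forall x, `|(g \o f) x| <= M * `|x|.
Proof.
have [Mg Mg0 gM] := @bounded_subproof _ _ _ g.
have [Mf Mf0 fM] := @bounded_subproof _ _ _ f.
exists (Mg * Mf) => [|x /=]; first exact: mulr_ge0.
by apply: le_trans (gM _) _; rewrite -mulrA ler_wpM2l.
Qed.

HB.instance Definition _ := isBounded.Build C H L (g \o f) comp_bounded.

End BoundedComp.

(* The library norm on [H1 * H2] is the max norm, hence an alias carrying the
   Hilbert direct sum structure. *)
Definition hsum (C : numClosedFieldType) (H1 H2 : hilbertType C) : Type :=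
  (H1 * H2)%type.

Section DirectSum.
Context {C : numClosedFieldType} (H1 H2 : hilbertType C).
Local Notation V := (hsum H1 H2).

HB.instance Definition _ := GRing.Lmodule.copy V (H1 * H2)%type.

Definition hsum_inner (x y : V) : C := inner x.1 y.1 + inner x.2 y.2.

Definition hsum_norm (x : V) : C := sqrtC (hsum_inner x x).

Let hsum_normE x : hsum_norm x = sqrtC ((`|x.1| : C) ^+ 2 + (`|x.2| : C) ^+ 2).
Proof. by rewrite /hsum_norm /hsum_inner !sqr_norm_inner. Qed.

Let minkowski2 (a b c d : C) : 0 <= a -> 0 <= b -> 0 <= c -> 0 <= d ->
  sqrtC ((a + c) ^+ 2 + (b + d) ^+ 2)
  <= sqrtC (a ^+ 2 + b ^+ 2) + sqrtC (c ^+ 2 + d ^+ 2).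
Proof.
move=> a0 b0 c0 d0.
have ab0 : 0 <= a ^+ 2 + b ^+ 2 by rewrite addr_ge0// exprn_ge0.
have cd0 : 0 <= c ^+ 2 + d ^+ 2 by rewrite addr_ge0// exprn_ge0.
have s2 := sqrtCK (a ^+ 2 + b ^+ 2); have t2 := sqrtCK (c ^+ 2 + d ^+ 2).
move: (sqrtC (a ^+ 2 + b ^+ 2)) (sqrtC_ge0 (a ^+ 2 + b ^+ 2)) s2 => s.
rewrite ab0 => s0 s2.
move: (sqrtC (c ^+ 2 + d ^+ 2)) (sqrtC_ge0 (c ^+ 2 + d ^+ 2)) t2 => t.
rewrite cd0 => t0 t2.
have st0 : 0 <= s + t by exact: addr_ge0.
rewrite -(sqrCK st0) ler_sqrtC ?nnegrE ?exprn_ge0//; last first.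
  by rewrite addr_ge0// exprn_ge0// addr_ge0.
rewrite -subr_ge0.
have -> : (s + t) ^+ 2 - ((a + c) ^+ 2 + (b + d) ^+ 2) =
    (s * t - (a * c + b * d)) *+ 2.
  by rewrite sqrrD s2 t2; ring.
rewrite mulrn_wge0// subr_ge0.
have w0 : 0 <= a * c + b * d by rewrite addr_ge0// mulr_ge0.
rewrite -(sqrCK w0) -(sqrCK (mulr_ge0 s0 t0)) ler_sqrtC ?nnegrE ?exprn_ge0//;
  last exact: mulr_ge0.
rewrite -subr_ge0 exprMn s2 t2.
have -> : (a ^+ 2 + b ^+ 2) * (c ^+ 2 + d ^+ 2) - (a * c + b * d) ^+ 2 =
  (a * d - b * c) ^+ 2 by ring.
by rewrite real_exprn_even_ge0// rpredB// rpredM// ger0_real.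
Qed.

Let ler_hsum_normD x y : hsum_norm (x + y) <= hsum_norm x + hsum_norm y.
Proof.
rewrite !hsum_normE; apply: le_trans (minkowski2 _ _ _ _); rewrite ?normr_ge0//.
rewrite ler_sqrtC ?nnegrE ?addr_ge0 ?exprn_ge0 ?addr_ge0//.
by apply: lerD; rewrite ler_pXn2r ?nnegrE ?addr_ge0//; exact: ler_normD.
Qed.

Let hsum_normZ (l : C) x : hsum_norm (l *: x) = `|l| * hsum_norm x.
Proof.
rewrite !hsum_normE !normrZ !exprMn -mulrDr sqrtCM ?nnegrE ?exprn_ge0//.
by rewrite sqrCK.
Qed.

Let hsum_norm0_eq0 x : hsum_norm x = 0 -> x = 0.
Proof.
rewrite hsum_normE => /eqP; rewrite sqrtC_eq0 paddr_eq0 ?exprn_ge0//.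
by rewrite !sqrf_eq0 !normr_eq0 => /andP[/eqP x1 /eqP x2]; case: x x1 x2 => ? ? /= -> ->.
Qed.

HB.instance Definition _ :=
  Lmodule_isNormed.Build C V ler_hsum_normD hsum_normZ hsum_norm0_eq0.

Let hsum_normrE (x : V) : `|x| = sqrtC ((`|x.1| : C) ^+ 2 + (`|x.2| : C) ^+ 2).
Proof. exact: hsum_normE. Qed.

Lemma hsum_norm1_le (x : V) : `|x.1| <= `|x|.
Proof.
rewrite hsum_normrE -[leLHS]sqrCK// ler_sqrtC ?nnegrE ?addr_ge0 ?exprn_ge0//.
by rewrite lerDl exprn_ge0.
Qed.

Lemma hsum_norm2_le (x : V) : `|x.2| <= `|x|.
Proof.
rewrite hsum_normrE -[leLHS]sqrCK// ler_sqrtC ?nnegrE ?addr_ge0 ?exprn_ge0//.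
by rewrite lerDr exprn_ge0.
Qed.

Lemma hsum_norm_leD (x : V) : `|x| <= `|x.1| + `|x.2|.
Proof.
rewrite hsum_normrE -[leRHS]sqrCK ?addr_ge0// ler_sqrtC ?nnegrE ?addr_ge0 ?exprn_ge0 ?addr_ge0//.
by rewrite sqrrD addrAC lerDl mulrn_wge0// mulr_ge0.
Qed.

Let hsum_complete (F : set_system V) : ProperFilter F -> cauchy F -> cvg F.
Proof.
move=> FF /cauchyP Fc.
have c1 : cvg (fst @ F).
  apply: cauchy_cvg; apply/cauchy_exP => e e0; have [x Fx] := Fc _ e0.
  exists x.1; change (F [set y : V | ball x.1 e y.1]); apply: filterS Fx => y.
  by rewrite -!ball_normE/=; apply: le_lt_trans; exact: hsum_norm1_le (x - y).
have c2 : cvg (snd @ F).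
  apply: cauchy_cvg; apply/cauchy_exP => e e0; have [x Fx] := Fc _ e0.
  exists x.2; change (F [set y : V | ball x.2 e y.2]); apply: filterS Fx => y.
  by rewrite -!ball_normE/=; apply: le_lt_trans; exact: hsum_norm2_le (x - y).
have /cvg_ex[l1 /cvgrPdist_lt l1P] := c1.
have /cvg_ex[l2 /cvgrPdist_lt l2P] := c2.
apply/cvg_ex; exists ((l1, l2) : V); apply/cvgrPdist_lt => e e0.
have e20 : 0 < e / 2 by rewrite divr_gt0.
apply: filterS2 (l1P _ e20) (l2P _ e20) => y y1 y2.
apply: le_lt_trans (hsum_norm_leD _) _ => /=.
by rewrite [e]splitr; exact: ltrD.
Qed.

HB.instance Definition _ := Uniform_isComplete.Build V hsum_complete.

Let hsum_inner_linearl y : linear_for *%R (hsum_inner ^~ y).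
Proof. by move=> a u v; rewrite /hsum_inner /= !inner_linearl; ring. Qed.

Let hsum_inner_conj x y : hsum_inner x y = (hsum_inner y x)^*.
Proof.
by rewrite /hsum_inner rmorphD/= (inner_conj x.1 y.1) (inner_conj x.2 y.2).
Qed.

HB.instance Definition _ :=
  isHilbert.Build C V hsum_inner_linearl hsum_inner_conj (fun=> erefl).

End DirectSum.

Section Block.
Context {C : numClosedFieldType} {H1 H2 : hilbertType C}.
Variables (A : 'B(H1, H1)) (B : 'B(H2, H1)) (C' : 'B(H1, H2)) (D : 'B(H2, H2)).

(* the operator matrix [[A, B], [C', D]] *)
Definition block_op (x : hsum H1 H2) : hsum H1 H2 :=
  (A x.1 + B x.2, C' x.1 + D x.2).

Let block_op_linear : linear block_op.
Proof.
move=> a u v.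
have hsumP (p q : hsum H1 H2) : a *: p + q = (a *: p.1 + q.1, a *: p.2 + q.2).
  by [].
by rewrite !hsumP /block_op/= !linearP !scalerDr; congr pair; rewrite addrACA.
Qed.

HB.instance Definition _ :=
  GRing.isLinear.Build C (hsum H1 H2) (hsum H1 H2) *:%R block_op block_op_linear.

Let block_op_bounded :
  exists2 M : C, 0 <= M & forall x, `|block_op x| <= M * `|x|.
Proof.
have [a a0 aP] := @bounded_subproof _ _ _ A.
have [b b0 bP] := @bounded_subproof _ _ _ B.
have [c c0 cP] := @bounded_subproof _ _ _ C'.
have [d d0 dP] := @bounded_subproof _ _ _ D.
exists ((a + b) + (c + d)) => [|x]; first by rewrite !addr_ge0.
apply: le_trans (hsum_norm_leD _) _; rewrite mulrDl !(mulrDl _ _ `|x|) /=.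
apply: lerD; apply: le_trans (ler_normD _ _) _; apply: lerD.
- by apply: le_trans (aP _) _; rewrite ler_wpM2l// hsum_norm1_le.
- by apply: le_trans (bP _) _; rewrite ler_wpM2l// hsum_norm2_le.
- by apply: le_trans (cP _) _; rewrite ler_wpM2l// hsum_norm1_le.
- by apply: le_trans (dP _) _; rewrite ler_wpM2l// hsum_norm2_le.
Qed.

HB.instance Definition _ :=
  isBounded.Build C (hsum H1 H2) (hsum H1 H2) block_op block_op_bounded.

End Block.

Section Radius.
Local Open Scope complex_scope.
Context {R : realType}.

(* [complex.Re] takes the [R]-valued modulus out of the [R[i]]-valued one *)
Definition opnorm (H K : hilbertType R[i]) (S : 'B(H, K)) : R :=
  sup [set complex.Re `|S x| | x in [set x : H | `|x| <= 1]].

(* on the zero space the set is empty and the supremum is 0 *)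
Definition numrad (H : hilbertType R[i]) (S : 'B(H, H)) : R :=
  sup [set complex.Re `|inner (S x) x| | x in [set x : H | `|x| = 1]].

End Radius.

(* Main.v *)
Require Import Defs.
From mathcomp Require Import all_boot all_order all_algebra complex.
From mathcomp Require Import sesquilinear ring lra.
From mathcomp Require Import all_classical all_reals all_analysis.

Set Implicit Arguments.
Unset Strict Implicit.
Unset Printing Implicit Defensive.

Import Order.TTheory GRing.Theory Num.Theory.
Import numFieldNormedType.Exports.

Local Open Scope ring_scope.

(** The value of the quadratic form of T at a unit vector (x, y) is
    <Ax, x> + <Dy, y> + (<By, x> + <Cx, y>).  If the cross term is at most
    2 alpha |x| |y|, the whole is at most w(A) p^2 + w(D) q^2 + 2 alpha p q with
    p = |x|, q = |y| and p^2 + q^2 = 1, and the maximum of this form is the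
    largest eigenvalue of the real symmetric matrix with rows (w(A), alpha) and
    (alpha, w(D)), which is the right-hand side ([quadratic_form_le]).

    For the cross term, write <Cx, y> = <x, z> with z = C^* y.  After a rotation
    by a phase e, |<By, x> + <x, z>| becomes Re <e By + e^* z, x>, hence is at
    most |e By + e^* z| |x|; expanding the square of the first factor gives
    |By|^2 + |z|^2 + 2 Re (e^2 <By, z>), where <By, z> = <CBy, y> brings in the
    numerical radius of CB ([pencil_norm_le]).  So, in [offdiag_le],
      |<By, x> + <Cx, y>|^2 <= (|B|^2 + |C|^2 + 2 w(CB)) |x|^2 |y|^2.
    With m = |B|^2 + |C|^2 and w = w(CB), the inequality
    (m + 2 w)^2 <= 2 (m^2 + 4 w^2) turns the constant into 4 alpha_1^2
    ([fourth_root_sqr_ge]).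

    Only the inner products of z with By and with x are ever used, so z may be
    any vector of norm at most |C| |y| representing v |-> <Cv, y> on the span of
    these two vectors, and a Gram-Schmidt step gives one
    ([two_point_adjoint]). *)

(** * Inner products *)

Section InnerProduct.
Context {C : numClosedFieldType} {H : hilbertType C}.
Implicit Types (u v x z : H) (a : C).

Lemma innerDl u v x : inner (u + v) x = inner u x + inner v x.
Proof. exact: (linearDl (inner : {bilinear _ -> _ -> _ | _ & _})). Qed.

Lemma innerDr u v x : inner x (u + v) = inner x u + inner x v.
Proof. by rewrite inner_conj innerDl rmorphD/= -!inner_conj. Qed.

Lemma innerZl a u v : inner (a *: u) v = a * inner u v.
Proof. exact: (linearZl_LR (inner : {bilinear _ -> _ -> _ | _ & _})). Qed.

Lemma innerZr a u v : inner u (a *: v) = a^* * inner u v.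
Proof. by rewrite inner_conj innerZl rmorphM/= -inner_conj. Qed.

Lemma inner0l x : inner 0 x = 0.
Proof. by rewrite -[0](scale0r 0) innerZl mul0r. Qed.

Lemma inner_ge0 x : 0 <= inner x x.
Proof. by rewrite -sqr_norm_inner exprn_ge0. Qed.

Lemma inner_eq0 x : (inner x x == 0) = (x == 0).
Proof. by rewrite -sqr_norm_inner sqrf_eq0 normr_eq0. Qed.

Lemma normr_innerC u v : `|inner u v| = `|inner v u|.
Proof. by rewrite inner_conj norm_conjC. Qed.

Lemma inner_CauchySchwarz u v : `|inner u v| <= (`|u| : C) * `|v|.
Proof.
rewrite -ler_sqr ?nnegrE ?mulr_ge0// exprMn !sqr_norm_inner.
have [->|v0] := eqVneq v 0.
  by rewrite normr_innerC !inner0l normr0 expr0n mulr0.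
have vv0 : inner v v != 0 by rewrite inner_eq0.
have := inner_ge0 (u - (inner u v / inner v v) *: v).
rewrite -scaleNr !(innerDl, innerDr, innerZl, innerZr).
rewrite rmorphN rmorphM fmorphV/= -(inner_conj v v) -(inner_conj v u) => h.
rewrite -subr_ge0 normCK -inner_conj.
rewrite (_ : _ - _ = inner v v * (inner u u +
   - (inner v u / inner v v) * inner u v +
   (- (inner u v / inner v v) * inner v u +
   - (inner v u / inner v v) * (- (inner u v / inner v v) * inner v v)))).
  by rewrite mulr_ge0// ?inner_ge0//; move: h; congr (_ <= _); ring.
by field.
Qed.

(** With g the sum on the left, the phase is absorbed by testing against
    v = g^* u + g z: the numbers <v, x> and <x, v> add up to 2 |g|^2, while
    |v|^2 is at most |g|^2 times the first factor on the right. *)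
Lemma pencil_norm_le u z x :
  `|inner u x + inner x z| ^+ 2 <=
  ((`|u| : C) ^+ 2 + `|z| ^+ 2 + 2 * `|inner u z|) * `|x| ^+ 2.
Proof.
set g := inner u x + inner x z; set M := (X in X * _).
have M0 : 0 <= M by rewrite !addr_ge0 ?exprn_ge0 ?mulr_ge0.
have [->|g0] := eqVneq g 0; first by rewrite normr0 expr0n mulr_ge0 ?exprn_ge0.
pose v := g^* *: u + g *: z.
have gv : `|g| ^+ 2 <= `|inner v x|.
  rewrite -(@ler_pM2l _ 2)//.
  have -> : 2 * `|g| ^+ 2 = inner v x + inner x v.
    rewrite /v !(innerDl, innerDr, innerZl, innerZr) conjCK normCK.
    have -> : g^* = inner x u + inner z x by rewrite /g rmorphD/= -!inner_conj.
    by rewrite /g; ring.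
  apply: le_trans (real_ler_norm _) _.
    by rewrite CrealE rmorphD/= -!inner_conj addrC.
  by apply: le_trans (ler_normD _ _) _; rewrite (normr_innerC x) mulr_natl.
have vM : (`|v| : C) ^+ 2 <= `|g| ^+ 2 * M.
  rewrite -[_ ^+ 2]ger0_norm ?exprn_ge0// sqr_norm_inner.
  rewrite /v !(innerDl, innerDr, innerZl, innerZr) conjCK !mulrDr.
  apply: le_trans (ler_normD _ _) _.
  apply: le_trans (lerD (ler_normD _ _) (ler_normD _ _)) _.
  rewrite !normrM norm_conjC -!sqr_norm_inner !normrX !normr_id.
  by rewrite (normr_innerC z) /M le_eqVlt; apply/orP; left; apply/eqP; ring.
rewrite -(@ler_pM2l _ (`|g| ^+ 2)) ?exprn_gt0 ?normr_gt0//.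
have gv2 : `|g| ^+ 2 * `|g| ^+ 2 <= `|inner v x| ^+ 2.
  by rewrite -expr2 ler_sqr ?nnegrE ?exprn_ge0.
apply: le_trans gv2 _.
have cs : `|inner v x| ^+ 2 <= ((`|v| : C) * `|x|) ^+ 2.
  by rewrite ler_sqr ?nnegrE ?mulr_ge0 ?inner_CauchySchwarz.
by apply: le_trans cs _; rewrite exprMn [leRHS]mulrA ler_wpM2r ?exprn_ge0.
Qed.

End InnerProduct.

(** A substitute for the adjoint S^* y that is faithful only against u and x.
    Replacing x by its component r orthogonal to u, the combination of u and r
    whose coefficients are read off from v |-> <Sv, y> works; it lies in the span
    of u and r, so that <z, z> = <Sz, y>, whence the norm bound. *)
Lemma two_point_adjoint (C : numClosedFieldType) (H K : hilbertType C)
    (S : {linear H -> K}) (M : C) (u x : H) (y : K) :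
  0 <= M -> (forall v, `|S v| <= M * `|v|) ->
  exists z : H, [/\ inner u z = inner (S u) y, inner x z = inner (S x) y
    & `|z| <= M * `|y|].
Proof.
move=> M0 SM.
pose a := inner x u / inner u u; pose r := x - a *: u.
have xE : x = r + a *: u by rewrite subrK.
have ru : inner r u = 0.
  rewrite /r -scaleNr innerDl innerZl mulNr /a.
  have [->|u0] := eqVneq u 0; last by rewrite divfK ?subrr ?inner_eq0.
  by rewrite (inner_conj x) !inner0l conjC0 mulr0 subr0.
have ur : inner u r = 0 by rewrite inner_conj ru conjC0.
(* From here on only x = r + a u with r orthogonal to u matters. *)
clearbody r a; rewrite {}xE.
(* Division by zero gives k 0 = 0, so kE needs no case distinction on u or r. *)
pose k v := (inner (S v) y / inner v v)^*.
have kE v : (k v)^* * inner v v = inner (S v) y.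
  rewrite /k conjCK.
  have [->|v0] := eqVneq v 0; last by rewrite divfK ?inner_eq0.
  by rewrite linear0 !inner0l mulr0.
pose z := k u *: u + k r *: r.
have uz : inner u z = inner (S u) y.
  by rewrite /z innerDr !innerZr ur mulr0 addr0 kE.
have rz : inner r z = inner (S r) y.
  by rewrite /z innerDr !innerZr ru mulr0 add0r kE.
exists z; split => //.
  by rewrite linearD linearZ !innerDl !innerZl uz rz.
have zz : inner z z = inner (S z) y.
  by rewrite {1}/z /z linearD !linearZ !innerDl !innerZl uz rz.
have [->|z0] := eqVneq z 0; first by rewrite normr0 mulr_ge0.
rewrite -(@ler_pM2r _ `|z|) ?normr_gt0// -expr2 sqr_norm_inner.
rewrite -[inner z z]ger0_norm ?inner_ge0// zz.
apply: le_trans (inner_CauchySchwarz _ _) _.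
by rewrite mulrAC ler_wpM2r.
Qed.

Local Open Scope complex_scope.

(** * Operator norm and numerical radius *)

Section Radius.
Context {R : realType}.
Implicit Types H K : hilbertType R[i].

Lemma Re_ger0K (z : R[i]) : 0 <= z -> (complex.Re z)%:C = z.
Proof. by move=> z0; rewrite RRe_real ?ger0_real. Qed.

Lemma Re_le (z w : R[i]) : z <= w -> complex.Re z <= complex.Re w.
Proof. by rewrite lecE => /andP[]. Qed.

Lemma opnorm_ub H K (S : 'B(H, K)) x :
  `|x| <= 1 -> complex.Re `|S x| <= opnorm S.
Proof.
move=> x1; apply: ub_le_sup; last by exists x.
have [M M0 SM] := @bounded_subproof _ _ _ S.
exists (complex.Re M) => _ [v /= v1 <-]; apply: Re_le.
by apply: le_trans (SM v) _; rewrite ler_piMr.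
Qed.

Lemma numrad_ub H (S : 'B(H, H)) x :
  `|x| = 1 -> complex.Re `|inner (S x) x| <= numrad S.
Proof.
move=> x1; apply: ub_le_sup; last by exists x.
have [M M0 SM] := @bounded_subproof _ _ _ S.
exists (complex.Re M) => _ [v v1 <-]; apply: Re_le; rewrite /= in v1.
apply: le_trans (inner_CauchySchwarz _ _) _.
by have := SM v; rewrite v1 !mulr1.
Qed.

Lemma opnorm_ge0 H K (S : 'B(H, K)) : 0 <= opnorm S.
Proof. by have := @opnorm_ub _ _ S 0; rewrite linear0 !normr0 => ->. Qed.

Lemma numrad_ge0 H (S : 'B(H, H)) : 0 <= numrad S.
Proof.
rewrite /numrad; set E := (X in sup X).
have [->|/set0P[_ [x x1 _]]] := eqVneq E set0; first by rewrite sup0.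
by apply: le_trans _ (numrad_ub S x1); have := Re_le (normr_ge0 (inner (S x) x)).
Qed.

Lemma opnorm_le H K (S : 'B(H, K)) x : `|S x| <= (opnorm S)%:C * `|x|.
Proof.
have [->|x0] := eqVneq x 0; first by rewrite linear0 !normr0 mulr0.
have nx0 : 0 < `|x| by rewrite normr_gt0.
rewrite -ler_pdivrMr// mulrC -[`|x|^-1]ger0_norm ?invr_ge0//.
rewrite -normrZ -linearZ -[leLHS]Re_ger0K// lecR opnorm_ub//.
by rewrite normrZ ger0_norm ?invr_ge0// mulVf ?gt_eqF.
Qed.

Lemma numrad_le H (S : 'B(H, H)) x :
  `|inner (S x) x| <= (numrad S)%:C * `|x| ^+ 2.
Proof.
have [->|x0] := eqVneq x 0.
  by rewrite linear0 inner0l !normr0 expr0n mulr0.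
have nx0 : 0 < `|x| by rewrite normr_gt0.
rewrite -ler_pdivrMr ?exprn_gt0// mulrC -exprVn.
have -> : `|x|^-1 ^+ 2 * `|inner (S x) x| =
    `|inner (S (`|x|^-1 *: x)) (`|x|^-1 *: x)|.
  rewrite linearZ innerZl innerZr !normrM norm_conjC mulrA -expr2.
  by rewrite ger0_norm ?invr_ge0.
rewrite -[leLHS]Re_ger0K// lecR numrad_ub//.
by rewrite normrZ ger0_norm ?invr_ge0// mulVf ?gt_eqF.
Qed.

(** The estimate of the cross term: [pencil_norm_le] for By, x and a z playing
    the role of C^* y. *)
Lemma offdiag_le H1 H2 (B : 'B(H2, H1)) (C : 'B(H1, H2)) x y :
  `|inner (B y) x + inner (C x) y| ^+ 2 <=
  (opnorm B ^+ 2 + opnorm C ^+ 2 + 2 * numrad (C \o B))%:C *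
    (`|x| ^+ 2 * `|y| ^+ 2).
Proof.
have [z [Byz xz zC]] := two_point_adjoint (B y) x y
  (etrans (lecR _ _) (opnorm_ge0 C)) (opnorm_le C).
rewrite -xz; apply: le_trans (pencil_norm_le _ _ _) _.
rewrite [leRHS]mulrCA [leLHS]mulrC ler_wpM2l ?exprn_ge0// Byz.
rewrite [leRHS](_ : _ = ((opnorm B)%:C * `|y|) ^+ 2 +
  ((opnorm C)%:C * `|y|) ^+ 2 + 2 * ((numrad (C \o B))%:C * `|y| ^+ 2)).
  apply: lerD; last by rewrite ler_wpM2l//; exact: (numrad_le (C \o B)).
  by apply: lerD;
    rewrite lerXn2r ?nnegrE ?mulr_ge0 ?lecR ?opnorm_ge0 ?opnorm_le.
by rewrite !rmorphD !rmorphXn rmorphM rmorph_nat /=; ring.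
Qed.
End Radius.

(** * Scalar inequalities *)

(** On the unit circle p^2 = (1 + cos s) / 2 and 2 p q = sin s for some angle s;
    the inequality is then Cauchy-Schwarz for (a - d, 2 t) and (cos s, sin s). *)
Lemma quadratic_form_le (R : rcfType) (a d t p q : R) : p ^+ 2 + q ^+ 2 = 1 ->
  a * p ^+ 2 + d * q ^+ 2 + 2 * t * (p * q) <=
  2^-1 * (a + d + Num.sqrt ((a - d) ^+ 2 + 4 * t ^+ 2)).
Proof.
move=> pq1; set s := Num.sqrt _.
have : (a - d) * (p ^+ 2 - q ^+ 2) + 4 * t * (p * q) <= s.
  apply: le_trans (ler_norm _) _; rewrite -sqrtr_sqr ler_sqrt; last first.
    by rewrite addr_ge0 ?sqr_ge0// mulr_ge0 ?sqr_ge0.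
  rewrite [leRHS](_ : _ = ((a - d) ^+ 2 + 4 * t ^+ 2) *
    (p ^+ 2 + q ^+ 2) ^+ 2); last by rewrite pq1 expr1n mulr1.
  rewrite -subr_ge0 (_ : _ - _ = (2 * (a - d) * (p * q) - 2 * t * (p ^+ 2 - q ^+ 2)) ^+ 2).
    exact: sqr_ge0.
  by ring.
have -> : q ^+ 2 = 1 - p ^+ 2 by rewrite -pq1 addrC addKr.
lra.
Qed.

(** The square of the fourth root is a square root, and (m + 2 w)^2 / 16 is at
    most (m^2 + 4 w^2) / 8 by convexity of the square. *)
Lemma fourth_root_sqr_ge (R : realType) (m w X : R) : 0 <= m -> 0 <= w ->
  m ^+ 2 + 4 * w ^+ 2 <= X ->
  m + 2 * w <= 4 * ((8^-1 * X) `^ (4^-1)) ^+ 2.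
Proof.
move=> m0 w0 mX.
have X0 : 0 <= 8^-1 * X by have := sqr_ge0 m; have := sqr_ge0 w; lra.
have -> : ((8^-1 * X) `^ (4^-1)) ^+ 2 = Num.sqrt (8^-1 * X).
  rewrite -powR_mulrn ?powR_ge0// -powRrM -powR12_sqrt//.
  by congr (_ `^ _); lra.
rewrite -ler_pdivrMl// -[leLHS]ger0_norm; last by rewrite mulr_ge0//; lra.
rewrite -sqrtr_sqr ler_sqrt//.
have := sqr_ge0 (m - 2 * w); nra.
Qed.

(** * The block operator *)

Theorem theorem2p6 (R : realType) (H1 H2 : hilbertType R[i])
    (A : 'B(H1, H1)) (B : 'B(H2, H1)) (C : 'B(H1, H2)) (D : 'B(H2, H2)) :
  let T : 'B(hsum H1 H2, hsum H1 H2) := block_op A B C D in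
  let alpha1 : R :=
    (8^-1 * Num.max
      ((opnorm B ^+ 2 + opnorm C ^+ 2) ^+ 2 + 4 * numrad (B \o C) ^+ 2)
      ((opnorm B ^+ 2 + opnorm C ^+ 2) ^+ 2 + 4 * numrad (C \o B) ^+ 2))
      `^ (4^-1) in
  numrad T <=
    2^-1 * (numrad A + numrad D +
      Num.sqrt ((numrad A - numrad D) ^+ 2 + 4 * alpha1 ^+ 2)).
Proof.
lazy zeta; set T := (X in numrad X <= _); set alpha1 := (X in 4 * X ^+ 2).
set rhs := (X in _ <= X).
have a0 : 0 <= numrad A := numrad_ge0 A.
have d0 : 0 <= numrad D := numrad_ge0 D.
have al0 : 0 <= alpha1 by exact: powR_ge0.
have rhs0 : 0 <= rhs by rewrite mulr_ge0// !addr_ge0 ?sqrtr_ge0.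
rewrite [numrad T]/numrad; set E := (X in sup X).
(* On the zero space E is empty and its supremum is 0. *)
have [->|/set0P E0] := eqVneq E set0; first by rewrite sup0.
apply: ge_sup => // _ [z z1 <-]; rewrite /= in z1.
pose p := complex.Re `|z.1|; pose q := complex.Re `|z.2|.
have pE : p%:C = `|z.1| by exact: Re_ger0K.
have qE : q%:C = `|z.2| by exact: Re_ger0K.
have p0 : 0 <= p := Re_le (normr_ge0 z.1).
have q0 : 0 <= q := Re_le (normr_ge0 z.2).
have pq1 : p ^+ 2 + q ^+ 2 = 1.
  apply: (@complexI R); rewrite rmorphD !rmorphXn/= pE qE rmorph1.
  by rewrite !sqr_norm_inner -(expr1n _ 2) -z1 sqr_norm_inner.
apply: le_trans _ (quadratic_form_le (numrad A) (numrad D) alpha1 pq1).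
pose g := inner (B z.2) z.1 + inner (C z.1) z.2.
have gE : inner (T z) z = inner (A z.1) z.1 + inner (D z.2) z.2 + g.
  have -> : inner (T z) z =
    inner (A z.1 + B z.2) z.1 + inner (C z.1 + D z.2) z.2 by [].
  by rewrite !innerDl /g; ring.
have g_le : `|g| <= (2 * alpha1 * (p * q))%:C.
  rewrite -ler_sqr ?nnegrE ?normr_ge0 ?lecR ?mulr_ge0//.
  apply: le_trans (offdiag_le B C z.1 z.2) _.
  rewrite -pE -qE -!rmorphXn -!rmorphM lecR.
  rewrite [leRHS](_ : _ = 4 * alpha1 ^+ 2 * (p ^+ 2 * q ^+ 2)); last by ring.
  rewrite ler_wpM2r ?mulr_ge0 ?exprn_ge0//.
  apply: fourth_root_sqr_ge; rewrite ?addr_ge0 ?exprn_ge0 ?opnorm_ge0//.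
    exact: numrad_ge0.
  by rewrite le_max lexx orbT.
rewrite -lecR Re_ger0K// gE !rmorphD.
apply: le_trans (ler_normD _ _) _; apply: lerD => //.
apply: le_trans (ler_normD _ _) _.
by apply: lerD; rewrite rmorphM rmorphXn/= ?pE ?qE; exact: numrad_le.
Qed.
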